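(* Let $P_9=\{123,231,321\}$ and $a_n=|A_n(P_9)|$. Then $a_0=1$, $a_1=1$, $a_2=3$, $a_3=12$, and for all $n\ge 4$ $$a_n=6a_{n-1}-8a_{n-2}+2a_{n-3}.$$
   Context: A Ferrers board $F$ with $n$ rows and $n$ columns is drawn in French notation: left- and bottom-justified, row lengths weakly increasing from top to bottom. $\mathcal{F}_n$ is the family of such boards containing the staircase board (i.e. the $i$-th row from the top has at least $i$ cells for every $i$). A transversal of $F$ is a placement of $1$'s in cells of $F$ with exactly one $1$ in each row and column. Columns are numbered left to right and heights bottom to top; $\pi_c$ is the height of the $1$ in column $c$. A transversal contains a pattern $p\in\mathfrak{S}_k$ if there are columns $c_1<\cdots<c_k$ such that $\pi_{c_1}\cdots\pi_{c_k}$ is order-isomorphic to $p$ and all $k^2$ cells in these columns and in the rows of these $1$'s lie in $F$; otherwise it avoids $p$. $A_n(P)$ is the set of pairs $(T,F)$ with $F\in\mathcal{F}_n$ and $T$ a transversal of $F$ avoiding every pattern in $P$ (for $n=0$ the empty object is counted). Under the standard correspondence, $a_n=|A_n(P)|=|\mathcal{M}_n(P)|$, where $\mathcal{M}_n(P)$ is the set of perfect matchings on $\{1,\dots,2n\}$ avoiding every $p\in P$. Here a matching contains $p\in\mathfrak{S}_3$ if it has three arcs $B_1,B_2,B_3$ with opening (smaller) vertices $o(B_1)<o(B_2)<o(B_3)$, all three opening vertices smaller than all three closing vertices, and $c(B_i)<c(B_j)\iff p_i>p_j$ for the closing vertices (so $123$ is three nested arcs and $321$ is three mutually crossing arcs).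 *)

(* Defs.v *)
From mathcomp Require Import all_boot all_order all_fingroup all_algebra.

Set Implicit Arguments.
Unset Strict Implicit.
Unset Printing Implicit Defensive.

(* A family of row lengths: [F h] is the length of the row at height [h].
   Heights are numbered from the bottom and columns from the left, both from 0
   (French notation). *)
Definition row_lengths (n : nat) := {ffun 'I_n -> 'I_n.+1}.

Definition in_board n (F : row_lengths n) (c h : 'I_n) : bool := c < F h.

Definition ferrers n (F : row_lengths n) : bool :=
  [forall h1 : 'I_n, forall h2 : 'I_n, (h1 <= h2) ==> (F h2 <= F h1)].

(* The row numbered [i.+1] from the top is the one at height [rev_ord i].
   Taking i = n - 1 shows that the bottom row has length n, and every row is
   nonempty, so such a board has exactly n rows and n columns. *)
Definition contains_staircase n (F : row_lengths n) : bool :=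
  [forall i : 'I_n, i.+1 <= F (rev_ord i)].

Definition staircase_boards n : {set row_lengths n} :=
  [set F | ferrers F && contains_staircase F].

(* A placement with exactly one 1 in each row and column is recorded by the
   permutation sending each column to the height of its 1. *)
Definition transversal n (s : 'S_n) (F : row_lengths n) : bool :=
  [forall c : 'I_n, in_board F c (s c)].

Definition contains_pattern n (s : 'S_n) (F : row_lengths n)
    k (p : 'S_k) : bool :=
  [exists c : {ffun 'I_k -> 'I_n},
    [&& [forall i : 'I_k, forall j : 'I_k, (i < j) ==> (c i < c j)],
        [forall i : 'I_k, forall j : 'I_k, (s (c i) < s (c j)) == (p i < p j)]
      & [forall i : 'I_k, forall j : 'I_k, in_board F (c i) (s (c j))]]].

Definition avoiders n k (P : {set 'S_k}) : {set 'S_n * row_lengths n} :=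
  [set TF | [&& TF.2 \in staircase_boards n, transversal TF.1 TF.2
              & [forall p in P, ~~ contains_pattern TF.1 TF.2 p]]].

Definition one_line k (p : 'S_k) : seq nat := [seq (p i).+1 | i <- enum 'I_k].

Definition P9 : {set 'S_3} :=
  [set p | one_line p \in [:: [:: 1; 2; 3]; [:: 2; 3; 1]; [:: 3; 2; 1]]].

Definition a9 (n : nat) : nat := #|avoiders n P9|.

(* Main.v *)
Require Import Defs.
From mathcomp Require Import all_boot all_order all_fingroup all_algebra.
From mathcomp Require Import zify.

Set Implicit Arguments.
Unset Strict Implicit.
Unset Printing Implicit Defensive.

(** Read the boundary of a board from its top left to its bottom right corner:
    a step right opens a column, a step down closes a row, and with it the
    column whose 1 lies in that row.  This is the matching of the pair, column
    c being closed when its row, at height [s c], is reached.  Between two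
    steps, record the list of the open columns in the order in which they will
    be closed, i.e. by decreasing height.

    Three columns form a pattern whose cells all lie in the board exactly when
    they are open at the same time ([avoiders_triples]), so a pair avoids
    123, 231 and 321 as soon as each of these lists does.  Only eight of them
    do: by Erdos-Szekeres a word avoiding 123 and 321 has at most four letters,
    and 2143 is the only one with four letters that also avoids 231.  The
    pairs are therefore the closed walks of a finite automaton whose states,
    written as words of relative heights, are
    the empty word, 1, 12, 21, 132, 213, 312 and 2143.

    To count walks, [continuations n t] gathers the avoiding pairs of size n
    that begin by opening the columns of t, without closing any.  The next step
    either opens one more column, which is inserted somewhere in the closing
    order and only partitions the set ([card_continuations_split]), or closes
    the head of t, which deletes the top row and one column and leaves a pair
    of size n - 1 ([card_continuations_close]).  Write a, p, q, g for the
    numbers of continuations, at a given positive size, of 1, 12, 21 and 213.  A state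
    132 or 312 can only close into 12, and 2143 into 213, so one size later
    these numbers become
      p' = a + p,   g' = q + g,   q' = a + p + g',   a' = a + p' + q',
    where a is also the number of all avoiding pairs.  Hence q = p + g at every
    size, and (a, p, g) evolves by a matrix with characteristic polynomial
    X^3 - 6 X^2 + 8 X - 2. *)

(** * Patterns as triples of simultaneously open columns *)

(** The columns x, y, z are listed by decreasing height, which is their closing
    order.  In the pattern 123 the columns close from right to left; 231 and
    321 together say that the rightmost column closes last. *)
Definition closing_forbidden (x y z : nat) : bool :=
  (z < y < x) || (maxn x y < z).

(** Only the row of x is tested against the board: x is the highest of the
    three, so by the Ferrers shape the other two rows are at least as long. *)
Definition triple_avoiding n (s : 'S_n) (F : row_lengths n) : Prop :=
  forall x y z : 'I_n, s z < s y < s x -> maxn x (maxn y z) < F (s x) ->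
    ~~ closing_forbidden x y z.

Lemma ferrersP n (F : row_lengths n) :
  reflect (forall h1 h2 : 'I_n, h1 <= h2 -> F h2 <= F h1) (ferrers F).
Proof.
apply: (iffP forallP) => H h1.
  by move=> h2; move/forallP/(_ h2)/implyP: (H h1).
by apply/forallP => h2; apply/implyP; apply: H.
Qed.

(** Three of the nine comparisons suffice, as [s] and [p] are injective. *)
Lemma contains_pattern3 n (s : 'S_n) (F : row_lengths n) (p : 'S_3)
    (a b d : 'I_n) (i0 := ord0 : 'I_3) (i1 := inord 1 : 'I_3) (i2 := ord_max : 'I_3) :
  a < b < d ->
  (s a < s b) = (p i0 < p i1) -> (s a < s d) = (p i0 < p i2) ->
  (s b < s d) = (p i1 < p i2) ->
  d < F (s a) -> d < F (s b) -> d < F (s d) -> contains_pattern s F p.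
Proof.
move=> /andP[lab lbd] e01 e02 e12 Fa Fb Fd.
have flip m (q : 'S_m) i j : i != j -> (q i < q j) = ~~ (q j < q i).
  by case: (ltngtP (q i) (q j)) => // /val_inj/perm_inj -> /eqP.
have nab : a != b by rewrite -(inj_eq val_inj) neq_ltn lab.
have nbd : b != d by rewrite -(inj_eq val_inj) neq_ltn lbd.
have nad : a != d by rewrite -(inj_eq val_inj) neq_ltn (ltn_trans lab lbd).
have v1 : i1 = 1 :> nat by rewrite inordK.
have n01 : i0 != i1 by rewrite -(inj_eq val_inj) /= v1.
have n12 : i1 != i2 by rewrite -(inj_eq val_inj) /= v1.
have n02 : i0 != i2 by [].
have e10 : (s b < s a) = (p i1 < p i0) by rewrite flip 1?eq_sym // e01 -flip 1?eq_sym.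
have e20 : (s d < s a) = (p i2 < p i0) by rewrite flip 1?eq_sym // e02 -flip 1?eq_sym.
have e21 : (s d < s b) = (p i2 < p i1) by rewrite flip 1?eq_sym // e12 -flip 1?eq_sym.
have all3 (i : 'I_3) : [\/ i = i0, i = i1 | i = i2].
  case: i => [[|[|[|]]]] // ltm;
    [constructor 1|constructor 2|constructor 3]; apply: val_inj => //=; exact: esym v1.
pose c : {ffun 'I_3 -> 'I_n} := [ffun i => if i == i0 then a else if i == i1 then b else d].
have c0 : c i0 = a by rewrite ffunE eqxx.
have c1 : c i1 = b by rewrite ffunE eq_sym (negPf n01) eqxx.
have c2 : c i2 = d by rewrite ffunE eq_sym (negPf n02) eq_sym (negPf n12).
apply/existsP; exists c; apply/and3P; split; apply/forallP => i; apply/forallP => j.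
- by case: (all3 i) => ->; case: (all3 j) => ->; rewrite ?c0 ?c1 ?c2 ?v1 /=;
     apply/implyP; rewrite ?v1 //=; lia.
- apply/eqP.
  by case: (all3 i) => ->; case: (all3 j) => ->; rewrite ?c0 ?c1 ?c2 // !ltnn.
- rewrite /in_board.
  by case: (all3 i) => ->; case: (all3 j) => ->; rewrite ?c0 ?c1 ?c2 //; lia.
Qed.

Lemma one_line3 (p : 'S_3) :
  one_line p = [:: (p ord0).+1; (p (inord 1)).+1; (p ord_max).+1].
Proof.
rewrite /one_line !enum_ordSl enum_ord0 /=.
by do !congr cons; congr (nat_of_ord (p _)).+1; apply: val_inj; rewrite /= ?inordK.
Qed.

Lemma one_line3_surj (a b c : 'I_3) : uniq [:: a; b; c] ->
  exists p : 'S_3, one_line p = [:: a.+1; b.+1; c.+1].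
Proof.
move=> u.
have inj : injective (tnth [tuple a; b; c]) by apply/tuple_uniqP.
exists (perm inj); rewrite one_line3 !permE !(tnth_nth a) /= inordK //.
Qed.

(** For 123 the columns z < y < x carry the pattern; when z is the rightmost
    column, the order of x and y decides between 321 and 231. *)
Lemma avoiders_triples n (s : 'S_n) (F : row_lengths n) : ferrers F ->
  reflect (triple_avoiding s F) [forall p in P9, ~~ contains_pattern s F p].
Proof.
move=> /ferrersP Fmono; apply: (iffP forall_inP) => [avP x y z | avT p].
  move=> /andP[szy syx] /[!gtn_max] /and3P[Fx Fy Fz]; apply/negP.
  have Fxy := Fmono _ _ (ltnW syx); have Fxz := Fmono _ _ (ltnW (ltn_trans szy syx)).
  have pat (a b c : 'I_3) : uniq [:: a; b; c] ->
    [:: a.+1; b.+1; c.+1] \in [:: [:: 1; 2; 3]; [:: 2; 3; 1]; [:: 3; 2; 1]] ->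
    exists2 p : 'S_3, p \in P9 & [/\ p ord0 = a, p (inord 1) = b & p ord_max = c].
    move=> u inP; have [p pE] := one_line3_surj u.
    exists p; first by rewrite inE pE.
    by move: pE; rewrite one_line3 => -[? ? ?]; split; apply: val_inj.
  case/orP => [/andP[zy yx]|].
    have [||p pP [p0 p1 p2]] := pat ord0 (inord 1) ord_max;
      rewrite /= ?inE -?(inj_eq val_inj) /= ?inordK //.
    move/negP: (avP p pP); apply.
    apply: (@contains_pattern3 _ _ _ _ z y x); rewrite ?p0 ?p1 ?p2 /= ?inordK //; lia.
  rewrite gtn_max => /andP[xz yz].
  have nxy : x != y :> nat by apply: contraTneq syx => /val_inj ->; rewrite ltnn.
  case: (ltngtP x y) nxy => // [xy _|yx _].
    have [||p pP [p0 p1 p2]] := pat ord_max (inord 1) ord0;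
      rewrite /= ?inE -?(inj_eq val_inj) /= ?inordK //.
    move/negP: (avP p pP); apply.
    apply: (@contains_pattern3 _ _ _ _ x y z); rewrite ?p0 ?p1 ?p2 /= ?inordK //; lia.
  have [||p pP [p0 p1 p2]] := pat (inord 1) ord_max ord0;
      rewrite /= ?inE -?(inj_eq val_inj) /= ?inordK //.
  move/negP: (avP p pP); apply.
  apply: (@contains_pattern3 _ _ _ _ y x z); rewrite ?p0 ?p1 ?p2 /= ?inordK //; lia.
rewrite inE one_line3 => inP; apply/existsP => -[c].
case/and3P => [/'forall_forallP cmono /'forall_forallP cs /'forall_forallP cF].
have v1 : (inord 1 : 'I_3) = 1 :> nat by rewrite inordK.
have := cmono ord0 (inord 1); have := cmono (inord 1) ord_max; rewrite !v1 /= => c12 c01.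
have := cs ord0 (inord 1); have := cs (inord 1) ord_max; have := cs ord0 ord_max.
have := cs (inord 1) ord0; have := cs ord_max (inord 1); have := cs ord_max ord0.
have F2 i : c ord_max < F (s (c i)) := cF ord_max i.
have F1 i : c (inord 1) < F (s (c i)) := cF (inord 1) i.
have F0 i : c ord0 < F (s (c i)) := cF ord0 i.
move: inP; rewrite !inE => /or3P[] /eqP[-> -> ->] /=
  /eqP s20 /eqP s21 /eqP s10 /eqP s02 /eqP s12 /eqP s01.
- have := avT (c ord_max) (c (inord 1)) (c ord0); rewrite /closing_forbidden s01 s12.
  by rewrite !gtn_max F2 F1 F0 c12 c01 => /(_ isT isT).
- have := avT (c (inord 1)) (c ord0) (c ord_max); rewrite /closing_forbidden s01 s20.
  by rewrite !gtn_max F2 F1 F0 c12 (ltn_trans c01 c12) orbT => /(_ isT isT).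
have := avT (c ord0) (c (inord 1)) (c ord_max); rewrite /closing_forbidden s10 s21.
by rewrite !gtn_max F2 F1 F0 c12 (ltn_trans c01 c12) orbT => /(_ isT isT).
Qed.

(** The row at height [h] is the row numbered [n - h] from the top. *)
Record avoiding_pair n (x : 'S_n * row_lengths n) : Prop := AvoidingPair {
  pair_ferrers : forall h1 h2 : 'I_n, h1 <= h2 -> x.2 h2 <= x.2 h1;
  pair_staircase : forall h : 'I_n, n - h <= x.2 h;
  pair_transversal : forall c : 'I_n, c < x.2 (x.1 c);
  pair_triples : triple_avoiding x.1 x.2 }.

Lemma avoidersP n (x : 'S_n * row_lengths n) :
  reflect (avoiding_pair x) (x \in avoiders n P9).
Proof.
case: x => s F; rewrite inE /= inE.
apply: (iffP and3P) => [[/andP[fF sF] /forallP tr /(avoiders_triples _ fF) av]|[] /= fF sF tr av].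
  split=> //=; first exact/ferrersP.
  move=> h; move/forallP/(_ (rev_ord h)): sF; rewrite rev_ordK /=.
  by have := ltn_ord h; lia.
have /ferrersP fF' := fF.
split; last exact/avoiders_triples.
  rewrite fF'; apply/forallP => i; apply: leq_trans (sF _) => /=.
  by have := ltn_ord i; lia.
exact/forallP.
Qed.

(** * Pairs beginning with given open columns *)

(** Columns are taken in [nat] so that one list of columns makes sense for every
    n; the value 0 outside of the range of columns is never looked at, as lists
    of open columns have their entries below n. *)
Definition height n (s : 'S_n) (c : nat) : nat :=
  nth 0 [seq val (s i) | i <- enum 'I_n] c.

Lemma heightE n (s : 'S_n) (c : 'I_n) : height s c = s c.
Proof. by rewrite /height (nth_map c) ?size_enum_ord ?nth_ord_enum. Qed.

Lemma height_ord n (s : 'S_n) c (ltc : c < n) : height s c = s (Ordinal ltc).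
Proof. exact: (heightE s (Ordinal ltc)). Qed.

(** [t] lists the first [size t] columns in closing order: they are all opened
    before any row is closed, i.e. they meet every row. *)
Definition starts_with n (x : 'S_n * row_lengths n) (t : seq nat) : bool :=
  [&& size t <= n, [forall h, size t <= x.2 h]
    & sorted gtn [seq height x.1 c | c <- t]].

Definition continuations n (t : seq nat) : {set 'S_n * row_lengths n} :=
  [set x in avoiders n P9 | starts_with x t].

Definition insert_at (T : Type) (i : nat) (x : T) (s : seq T) : seq T :=
  take i s ++ x :: drop i s.

Lemma gtn_trans : transitive gtn.
Proof. by move=> ? ? ? /= h1 h2; apply: ltn_trans h2 h1. Qed.

(** A new value fits at exactly one place of a decreasing sequence; stated as a
    sum because it is used by exchanging two summations. *)
Lemma sum_sorted_insert (a : nat) (s : seq nat) :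
  sorted gtn s -> a \notin s ->
  \sum_(i < (size s).+1) sorted gtn (insert_at i a s) = 1.
Proof.
have tr := gtn_trans.
elim: s => [|b s IHs] /=; first by rewrite big_ord_recl big_ord0.
rewrite path_sortedE // => /andP[b_s sorted_s].
rewrite inE negb_or => /andP[nab a_s].
rewrite big_ord_recl /insert_at /= path_sortedE // b_s sorted_s /= andbT.
have consE (i : nat) : path gtn b (take i s ++ a :: drop i s)
    = (a < b) && sorted gtn (insert_at i a s).
  rewrite path_sortedE // all_cat /= andbCA -all_cat cat_take_drop.
  by rewrite b_s andbT.
under eq_bigr => i _ do rewrite consE.
by case: (ltngtP a b) nab => //= ab _; [rewrite add0n IHs | rewrite big1].
Qed.

Lemma map_insert_at (T U : Type) (f : T -> U) i x s :
  map f (insert_at i x s) = insert_at i (f x) (map f s).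
Proof. by rewrite /insert_at map_cat /= map_take map_drop. Qed.

Lemma size_insert_at (T : Type) i (x : T) s : size (insert_at i x s) = (size s).+1.
Proof. by rewrite /insert_at size_cat /= addnS -size_cat cat_take_drop. Qed.

Lemma mem_state t c : perm_eq t (iota 0 (size t)) -> (c \in t) = (c < size t).
Proof. by move=> /perm_mem->; rewrite mem_iota. Qed.

(** After opening the columns of [t], either some row has length exactly
    [size t], and the next step closes a row, or every row reaches the column
    numbered [size t], which is then opened next and takes one of the
    [size t + 1] places in the closing order. *)
Lemma card_continuations_split n t : perm_eq t (iota 0 (size t)) ->
  #|continuations n.+1 t|
  = #|[set x in continuations n.+1 t | [exists h, x.2 h == size t :> nat]]|
    + \sum_(i < (size t).+1) #|continuations n.+1 (insert_at i (size t) t)|.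
Proof.
move=> state_t; set k := size t.
pose A := [set x : 'S_n.+1 * row_lengths n.+1 | [exists h, x.2 h == k :> nat]].
rewrite -(cardsID A); congr (_ + _).
  by apply: eq_card => x; rewrite !inE.
under eq_bigr => i _ do rewrite -sum1_card big_mkcond /=.
rewrite exchange_big /= -sum1_card big_mkcond /=; apply: eq_bigr => x _.
have stE i : starts_with x (insert_at i k t)
  = [&& k < n.+1, [forall h, k < x.2 h]
      & sorted gtn (insert_at i (height x.1 k) (map (height x.1) t))].
  by rewrite /starts_with size_insert_at map_insert_at.
have -> : (x \in continuations n.+1 t :\: A)
    = [&& x \in avoiders n.+1 P9, k < n.+1, [forall h, k < x.2 h]
      & sorted gtn (map (height x.1) t)].
  rewrite inE inE inE /starts_with -/k andbCA; congr (_ && _).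
  apply/and4P/and3P => [[/existsPn noF lekn /forallP leF ->]|[_ /forallP ltF ->]].
    have ltF h : k < x.2 h by rewrite ltn_neqAle leF andbT eq_sym noF.
    split=> //; last exact/forallP.
    by have := ltF ord0; have := ltn_ord (x.2 ord0); lia.
  split=> //.
  - by apply/existsPn => h; rewrite neq_ltn ltF orbT.
  - by have := ltF ord0; have := ltn_ord (x.2 ord0); lia.
  - by apply/forallP => h; exact: ltnW.
under [RHS]eq_bigr => i _ do rewrite inE stE.
case: ifP => [/and4P[-> ltkn -> sorted_t]|].
  rewrite ltkn /=.
  have := @sum_sorted_insert (height x.1 k) (map (height x.1) t) sorted_t.
  rewrite size_map => sum1; rewrite -[LHS]sum1; first by apply: eq_bigr => i _; case: ifP.
  apply/mapP => -[c c_t]; move: (c_t); rewrite mem_state // => ltck.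
  rewrite (height_ord _ ltkn) (height_ord _ (ltn_trans ltck ltkn)).
  move=> /val_inj/perm_inj[] e; by move: ltck; rewrite -e ltnn.
move=> nx; rewrite big1 // => i _; case: ifP => // /and4P[av ltkn ltF sorted_i].
move: nx; rewrite av ltkn ltF /=.
rewrite (subseq_sorted gtn_trans _ sorted_i) //.
rewrite -{1}(cat_take_drop i (map _ t)) /insert_at.
by rewrite cat_subseq // subseq_cons.
Qed.

(** * Lists of open columns that contain no pattern *)

(** A computable test, so that concrete states are handled by evaluation. *)
Definition allowed (t : seq nat) : bool :=
  all (fun l => all (fun j => all (fun i =>
    ~~ closing_forbidden (nth 0 t i) (nth 0 t j) (nth 0 t l))
    (iota 0 j)) (iota 0 l)) (iota 0 (size t)).

Lemma allowedP t :
  reflect (forall i j l, i < j < l -> l < size t ->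
    ~~ closing_forbidden (nth 0 t i) (nth 0 t j) (nth 0 t l)) (allowed t).
Proof.
apply: (iffP allP) => [H i j l /andP[ij jl] lt|H l].
  have /H/allP/(_ j) : l \in iota 0 (size t) by rewrite mem_iota.
  rewrite mem_iota => /(_ jl)/allP/(_ i); rewrite mem_iota; exact.
rewrite mem_iota => /andP[_ lt]; apply/allP => j; rewrite mem_iota => /andP[_ jl].
by apply/allP => i; rewrite mem_iota => /andP[_ ij]; apply: H; rewrite // ij.
Qed.

Lemma height_lt_nth n (s : 'S_n) t i j :
  sorted gtn [seq height s c | c <- t] -> i < j -> j < size t ->
  height s (nth 0 t j) < height s (nth 0 t i).
Proof.
move=> sorted_t ij jt; have it := ltn_trans ij jt.
rewrite -(nth_map 0 0) // -(nth_map 0 0 (height s)) //.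
by apply: (sorted_ltn_nth gtn_trans); rewrite ?inE ?size_map.
Qed.

Lemma continuations_forbidden n t : perm_eq t (iota 0 (size t)) ->
  ~~ allowed t -> continuations n t = set0.
Proof.
move=> state_t /negP bad; apply/setP => x; rewrite in_set0 inE.
apply/negP => /andP[/avoidersP [_ _ _ av] /and3P[tn /forallP tF sorted_t]].
apply: bad; apply/allowedP => i j l /andP[ij jl] lt.
have jt := ltn_trans jl lt; have it := ltn_trans ij jt.
have bnd e : e < size t -> nth 0 t e < size t by move=> et; rewrite -mem_state // mem_nth.
have ltn e (et : e < size t) : nth 0 t e < n := leq_trans (bnd e et) tn.
apply: (av (Ordinal (ltn i it)) (Ordinal (ltn j jt)) (Ordinal (ltn l lt))).
  by rewrite -!height_ord !height_lt_nth.
by rewrite !gtn_max /= !(leq_trans (bnd _ _) (tF _)).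
Qed.

Lemma forall_lift n (i : 'I_n.+1) (P : 'I_n.+1 -> Prop) :
  P i -> (forall j, P (lift i j)) -> forall j, P j.
Proof. by move=> Pi Pl j; case: (unliftP i j) => [j' ->|->]. Qed.

Lemma forbidden_bump a x y z :
  closing_forbidden (bump a x) (bump a y) (bump a z) = closing_forbidden x y z.
Proof. by rewrite /closing_forbidden /bump; case: leqP; case: leqP; case: leqP; lia. Qed.

(** * Closing a row *)

Section AddTopRow.
Variables (n k : nat) (m : 'I_n.+1).

(** The inverse of closing the column [m] : a row of length [k + 1] is put on
    top, and a column meeting every row, with its 1 in the new row, is inserted
    at [m]. *)
Definition add_top_row (x : 'S_n * row_lengths n) : 'S_n.+1 * row_lengths n.+1 :=
  (lift_perm m ord_max x.1,
   [ffun h => if unlift ord_max h is Some h' then lift ord0 (x.2 h')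
              else inord k.+1]).

Lemma add_top_row_inj : injective add_top_row.
Proof.
move=> [s F] [s' F'] [/= es eF]; congr pair.
  apply/permP => c; move/permP/(_ (lift m c)): es.
  by rewrite !lift_perm_lift => /lift_inj.
apply/ffunP => h; move/ffunP/(_ (lift ord_max h)): eF.
by rewrite !ffunE liftK => /lift_inj.
Qed.

Lemma add_top_row_perm_surj (s : 'S_n.+1) :
  s m = ord_max -> exists s' : 'S_n, s = lift_perm m ord_max s'.
Proof.
move=> sm.
have sP c : {h | s (lift m c) = lift ord_max h}.
  case: (unliftP ord_max (s (lift m c))) => [h ->|]; first by exists h.
  by rewrite -sm => /perm_inj/eqP; rewrite eq_sym (negPf (neq_lift _ _)).
have inj : injective (fun c => sval (sP c)).
  move=> c c' e; apply: (@lift_inj _ m); apply: (@perm_inj _ s).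
  by rewrite (svalP (sP c)) (svalP (sP c')) e.
exists (perm inj); apply/permP => c; case: (unliftP m c) => [c' ->|->].
  by rewrite lift_perm_lift permE -(svalP (sP c')).
by rewrite lift_perm_id.
Qed.

Hypothesis k_le_n : k <= n.

Lemma add_top_row_top x : (add_top_row x).2 ord_max = k.+1 :> nat.
Proof. by rewrite ffunE unlift_none inordK. Qed.

Lemma add_top_row_below x h : (add_top_row x).2 (lift ord_max h) = (x.2 h).+1 :> nat.
Proof. by rewrite ffunE liftK. Qed.

Lemma add_top_row_max x : (add_top_row x).1 m = ord_max.
Proof. exact: lift_perm_id. Qed.

Lemma add_top_row_lift x c : (add_top_row x).1 (lift m c) = lift ord_max (x.1 c).
Proof. exact: lift_perm_lift. Qed.

Lemma height_add_top_row x (t : seq nat) : (m : nat) \notin t ->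
  all (gtn n.+1) t ->
  [seq height (add_top_row x).1 c | c <- t]
  = [seq height x.1 c | c <- map (unbump m) t].
Proof.
move=> mt /allP tn; rewrite -map_comp; apply/eq_in_map => c ct /=.
have ltc : c < n.+1 := tn c ct.
rewrite (height_ord _ ltc); case: (unliftP m (Ordinal ltc)) => [c' e|e].
  rewrite e add_top_row_lift lift_max -heightE.
  by rewrite -(bumpK m c') -[bump m c']/(val (lift m c')) -e.
by case/negP: mt; rewrite -[m : nat]/(val m) -e.
Qed.

End AddTopRow.

Section CloseFirst.
Variables (n : nat) (m : nat) (t : seq nat).
Hypothesis state_mt : perm_eq (m :: t) (iota 0 (size t).+1).
Hypothesis allowed_mt : allowed (m :: t).
Hypothesis t_le_n : size t <= n.
Let k := size t.
Let t' := map (unbump m) t.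
Let mo : 'I_n.+1 := inord m.
Let f := @add_top_row n k mo.

Let memmt c : (c \in m :: t) = (c <= k).
Proof. by rewrite (perm_mem state_mt) mem_iota. Qed.

Let m_le_k : m <= k. Proof. by rewrite -memmt mem_head. Qed.

Let moE : mo = m :> nat.
Proof. by rewrite inordK // ltnS (leq_trans m_le_k). Qed.

Let m_notin_t : m \notin t.
Proof. by move: (perm_uniq state_mt); rewrite iota_uniq /= => /andP[]. Qed.

Let starts_with_f x : starts_with (f x) (m :: t) = starts_with x t'.
Proof.
rewrite /starts_with size_map ltnS; congr (_ && _).
have -> : [forall h, size (m :: t) <= (f x).2 h] = [forall h, size t <= x.2 h].
  apply/forallP/forallP => [H h|H].
    by have := H (lift ord_max h); rewrite add_top_row_below.
  apply: (@forall_lift _ ord_max) => [|h]; first by rewrite add_top_row_top.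
  by rewrite add_top_row_below ltnS.
congr (_ && _) => /=.
have tn : all (gtn n.+1) t.
  apply/allP => c ct /=; rewrite ltnS; apply: leq_trans t_le_n.
  by rewrite -/k -memmt inE ct orbT.
rewrite (path_sortedE gtn_trans) (@height_add_top_row _ k) ?moE // -/t'.
rewrite -[X in height _ X]moE heightE (@add_top_row_max _ k) /=.
rewrite (_ : all _ _ = true) //; apply/allP => h /mapP[_ /mapP[c ct ->] ->] /=.
have ck : c <= k by rewrite -memmt inE ct orbT.
have cn : unbump m c < n.
  have : c != m by apply: contraNneq m_notin_t => <-.
  by rewrite /unbump; case: leqP; lia.
by rewrite (height_ord _ cn) ltn_ord.
Qed.

(** Deletion can only destroy patterns.  Conversely, a triple of the larger pair
    that uses the new top row, of length [k + 1], consists of columns of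
    [m :: t], where [allowed_mt] excludes it. *)
Let avoiding_f x : starts_with x t' ->
  avoiding_pair (f x) <-> avoiding_pair x.
Proof.
move=> start_x.
have /and3P[_ /forallP kF _] := start_x.
move: (start_x); rewrite -starts_with_f => /and3P[_ _ sorted_f].
rewrite size_map -/k in kF.
split=> -[fF sF tr av]; split.
- move=> h1 h2 h12; have := fF (lift ord_max h1) (lift ord_max h2).
  by rewrite !add_top_row_below // !lift_max; apply.
- move=> h; have := sF (lift ord_max h); rewrite add_top_row_below // lift_max.
  by have := ltn_ord h; lia.
- move=> c; have := tr (lift mo c); rewrite add_top_row_lift add_top_row_below //=.
  by have := kF (x.1 c); rewrite /bump moE; case: leqP; lia.
- move=> a b c ord_abc /[!gtn_max] /and3P[Fa Fb Fc].
  rewrite -(forbidden_bump mo); apply: (av (lift mo a) (lift mo b) (lift mo c)).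
    by rewrite !add_top_row_lift !lift_max.
  rewrite add_top_row_lift add_top_row_below // !gtn_max /= /bump.
  by do 3 case: leqP; lia.
- apply: (@forall_lift _ ord_max) => [|h1].
    by move=> h2 /= nh2; have -> : h2 = ord_max by apply: val_inj => /=; have := ltn_ord h2; lia.
  apply: (@forall_lift _ ord_max) => [_|h2].
    by rewrite add_top_row_top // add_top_row_below // ltnS.
  by rewrite !lift_max !add_top_row_below // ltnS; apply: fF.
- apply: (@forall_lift _ ord_max) => [|h].
    by rewrite add_top_row_top //= subSn // subnn.
  by rewrite add_top_row_below // lift_max; have := sF h; lia.
- apply: (@forall_lift _ mo) => [|c].
    by rewrite add_top_row_max add_top_row_top // moE.
  rewrite add_top_row_lift add_top_row_below //= /bump.
  by have := tr c; case: leqP; lia.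
move=> a b c /andP[cb ba] Fabc.
have not_mo d e : (f x).1 d < (f x).1 e -> d != mo.
  apply: contraTneq => ->; rewrite add_top_row_max -leqNgt /=.
  by rewrite -ltnS.
have bm := not_mo _ _ ba; have cm := not_mo _ _ cb.
(* Only the highest column of the triple can be the one in the top row. *)
have [am|am] := eqVneq a mo.
  move: Fabc; rewrite am add_top_row_max add_top_row_top // !gtn_max !ltnS.
  case/and3P => _ bk ck.
  have in_t (d : 'I_n.+1) : d != mo -> d <= k -> (d : nat) \in t.
    move=> dm dk; have : (d : nat) \in m :: t by rewrite memmt.
    by rewrite inE -{1}moE; case/orP => // /eqP/val_inj e; rewrite e eqxx in dm.
  have bt := in_t _ bm bk; have ct := in_t _ cm ck.
  have bc : index (b : nat) t < index (c : nat) t.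
    rewrite ltnNge leq_eqVlt; apply/negP => /orP[/eqP e|cltb].
      have e' : (c : nat) = b by rewrite -(nth_index 0 ct) e nth_index.
      by move: cb; rewrite (val_inj e') ltnn.
    have := @height_lt_nth _ (f x).1 t (index (c : nat) t) (index (b : nat) t).
    rewrite !nth_index // !heightE => /(_ _ cltb); rewrite index_mem => /(_ (path_sorted sorted_f) bt).
    by rewrite ltnNge ltnW.
  have := allowedP _ allowed_mt 0 (index (b : nat) t).+1 (index (c : nat) t).+1.
  by rewrite /= moE ltnS bc !nth_index // ltnS index_mem ct => /(_ isT isT).
move: am bm cm cb ba Fabc {not_mo}.
case: (unliftP mo a) => [a' ->|->]; last by rewrite eqxx.
case: (unliftP mo b) => [b' ->|->]; last by rewrite eqxx.
case: (unliftP mo c) => [c' ->|->]; last by rewrite eqxx.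
move=> _ _ _; rewrite !add_top_row_lift !lift_max add_top_row_below // => cb ba.
rewrite !gtn_max /= => /and3P[Fa Fb Fc]; rewrite forbidden_bump; apply: av; first by rewrite cb.
have := kF (x.1 a').
rewrite !gtn_max; move: Fa Fb Fc; rewrite /bump moE; do 3 case: leqP; lia.
Qed.

(** The column closed first is [m], the highest one, so deleting it with the top
    row is inverse to [add_top_row]; the remaining columns are renumbered by
    [unbump m]. *)
Lemma card_continuations_close :
  #|[set x in continuations n.+1 (m :: t) | [exists h, x.2 h == size (m :: t) :> nat]]|
  = #|continuations n t'|.
Proof.
rewrite -(card_imset _ (@add_top_row_inj n k mo)); apply: eq_card => y.
apply/idP/imsetP => [|[x]].
  rewrite inE inE => /andP[/andP[/avoidersP av st] /existsP[h0 /eqP Fh0]].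
  have /and3P[_ /forallP leF sorted_y] := st.
  (* Row lengths decrease upwards, so a row of minimal length is the top one. *)
  have Ftop : y.2 ord_max = k.+1 :> nat.
    apply/eqP; rewrite eqn_leq leF andbT -[k.+1]Fh0.
    by apply: (pair_ferrers av); rewrite -ltnS.
  (* The 1 of the top row is in one of the open columns, and among these the
     head of the list is the highest. *)
  have ymax : y.1 mo = ord_max.
    pose c := (y.1^-1)%g ord_max.
    have yc : y.1 c = ord_max by rewrite permKV.
    have : (c : nat) \in m :: t.
      by rewrite memmt -ltnS -Ftop -yc; apply: (pair_transversal av).
    rewrite inE -{1}moE => /orP[/eqP/val_inj<- //|ct].
    have := @height_lt_nth _ y.1 (m :: t) 0 (index (c : nat) t).+1 sorted_y isT.
    rewrite /= ltnS index_mem ct => /(_ isT); rewrite nth_index // heightE yc.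
    by rewrite -moE heightE ltnNge -ltnS ltn_ord.
  have [s' es] := add_top_row_perm_surj ymax.
  pose F' : row_lengths n := [ffun h => inord (y.2 (lift ord_max h)).-1].
  have yE : y = f (s', F').
    rewrite [LHS]surjective_pairing es; congr pair; apply/ffunP.
    apply: (@forall_lift _ ord_max) => [|h]; apply: val_inj.
      by rewrite [RHS]add_top_row_top // [LHS]Ftop.
    have := leF (lift ord_max h); have := ltn_ord (y.2 (lift ord_max h)).
    rewrite [RHS]add_top_row_below // /= ffunE => Flt Fgt.
    by rewrite inordK prednK //; exact: leq_trans Fgt.
  exists (s', F'); last exact: yE.
  rewrite yE starts_with_f in st; rewrite inE st andbT; apply/avoidersP.
  by apply/avoiding_f; rewrite // -yE.
case/setIdP => /avoidersP av st ->.
rewrite inE inE starts_with_f st andbT; apply/andP; split.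
  by apply/avoidersP/avoiding_f.
by apply/existsP; exists ord_max; rewrite add_top_row_top.
Qed.
End CloseFirst.

(** * The automaton of allowed states *)

(** The new column is the rightmost one, hence its number [size t]. *)
Definition extensions (t : seq nat) : seq (seq nat) :=
  [seq u <- [seq insert_at i (size t) t | i <- iota 0 (size t).+1] | allowed u].

Lemma perm_insert_at t i : perm_eq t (iota 0 (size t)) ->
  perm_eq (insert_at i (size t) t) (iota 0 (size (insert_at i (size t) t))).
Proof.
move=> state_t; rewrite size_insert_at -addn1 iotaD add0n /insert_at.
apply: (@perm_trans _ (size t :: t)).
  by rewrite perm_catC /= perm_cons perm_catC cat_take_drop.
by rewrite perm_sym perm_catC /= perm_cons perm_sym.
Qed.

Lemma card_continuations_oversize n t : n < size t -> #|continuations n t| = 0.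
Proof.
by move=> ltn; apply: eq_card0 => x; rewrite inE /starts_with leqNgt ltn andbF.
Qed.

Lemma sum_extensions n t : perm_eq t (iota 0 (size t)) ->
  \sum_(i < (size t).+1) #|continuations n (insert_at i (size t) t)|
  = \sum_(u <- extensions t) #|continuations n u|.
Proof.
move=> state_t; rewrite big_filter big_map -[iota 0 _]/(index_iota 0 (size t).+1).
rewrite big_mkord [RHS]big_mkcond /=; apply: eq_bigr => i _; case: ifP => // /negbT bad.
by rewrite continuations_forbidden ?cards0 // perm_insert_at.
Qed.

(** If [n < size t] there is no room for the columns of [m :: t], and both sides
    vanish. *)
Lemma card_continuations_rec n m t :
  perm_eq (m :: t) (iota 0 (size t).+1) -> allowed (m :: t) ->
  #|continuations n.+1 (m :: t)| = #|continuations n (map (unbump m) t)|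
    + \sum_(u <- extensions (m :: t)) #|continuations n.+1 u|.
Proof.
move=> state_mt allowed_mt; rewrite -sum_extensions // card_continuations_split //.
have [tn|nt] := leqP (size t) n; first by rewrite card_continuations_close.
congr (_ + _); rewrite (card_continuations_oversize (t := map _ t)) ?size_map //.
apply: eq_card0 => x; apply/negP; rewrite !inE => /andP[/andP[_ /and3P[]]].
by rewrite /= ltnS leqNgt nt.
Qed.

(** With no open column, nothing can be closed: the staircase condition makes
    all rows nonempty. *)
Lemma card_continuations_start n :
  #|continuations n.+1 [::]| = #|continuations n.+1 [:: 0]|.
Proof.
rewrite card_continuations_split // big_ord_recl big_ord0 addn0.
rewrite -[RHS]add0n; congr (_ + _); apply: eq_card0 => x; apply/negP.
rewrite inE => /andP[/setIdP[/avoidersP av _] /existsP[h /eqP F0]].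
by have := pair_staircase av h; rewrite F0 /=; have := ltn_ord h; lia.
Qed.

Lemma a9E n : a9 n = #|continuations n [::]|.
Proof.
apply: eq_card => x; rewrite [RHS]inE /starts_with /= andbT.
by rewrite (introT forallP) ?andbT.
Qed.

Lemma a9_0 : a9 0 = 1.
Proof.
rewrite /a9 (eq_card (B := predT)) => [|x].
  by rewrite card_prod card_Sn card_ffun !card_ord.
by apply/avoidersP; split; try case.
Qed.

(** The field names give the states as words of relative heights, while the
    lists give the columns in closing order, i.e. by decreasing height. *)
Record state_counts (n a p q g : nat) : Prop := StateCounts {
  count_1 : #|continuations n [:: 0]| = a;
  count_12 : #|continuations n [:: 1; 0]| = p;
  count_21 : #|continuations n [:: 0; 1]| = q;
  count_213 : #|continuations n [:: 2; 0; 1]| = g }.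

Lemma state_counts1 : state_counts 1 1 0 0 0.
Proof.
split; try exact: card_continuations_oversize.
rewrite card_continuations_rec // -a9E a9_0.
by rewrite (_ : extensions _ = [:: [:: 1; 0]; [:: 0; 1]]) //
  !big_cons big_nil !card_continuations_oversize.
Qed.

(** Transitions: 1 opens to 12 or 21; 12 opens to 132; 21 opens to 213 or 312;
    213 opens to 2143; the states 132, 312 and 2143 can only close. *)
Lemma state_countsS n a p q g :
  state_counts n.+1 a p q g ->
  state_counts n.+2 (a + (a + p) + (a + p + (q + g))) (a + p) (a + p + (q + g)) (q + g).
Proof.
move=> [va vp vq vg].
have e132 : #|continuations n.+2 [:: 1; 2; 0]| = p.
  rewrite card_continuations_rec // -vp.
  by rewrite (_ : extensions _ = [::]) // big_nil addn0.
have e312 : #|continuations n.+2 [:: 0; 2; 1]| = p.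
  rewrite card_continuations_rec // -vp.
  by rewrite (_ : extensions _ = [::]) // big_nil addn0.
have e2143 : #|continuations n.+2 [:: 2; 3; 0; 1]| = g.
  rewrite card_continuations_rec // -vg.
  by rewrite (_ : extensions _ = [::]) // big_nil addn0.
have e213 : #|continuations n.+2 [:: 2; 0; 1]| = q + g.
  rewrite card_continuations_rec // -vq.
  by rewrite (_ : extensions _ = [:: [:: 2; 3; 0; 1]]) // big_cons big_nil addn0 e2143.
have e12 : #|continuations n.+2 [:: 1; 0]| = a + p.
  rewrite card_continuations_rec // -va.
  by rewrite (_ : extensions _ = [:: [:: 1; 2; 0]]) // big_cons big_nil addn0 e132.
have e21 : #|continuations n.+2 [:: 0; 1]| = a + p + (q + g).
  rewrite card_continuations_rec // (_ : extensions _ = [:: [:: 2; 0; 1]; [:: 0; 2; 1]]) //.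
  rewrite !big_cons big_nil addn0 e312 e213 -[map _ _]/[:: 0] va; lia.
split=> //; rewrite card_continuations_rec //= card_continuations_start va.
by rewrite (_ : extensions _ = [:: [:: 1; 0]; [:: 0; 1]]) //
  !big_cons big_nil addn0 e12 e21 addnA.
Qed.

(** The relation q = p + g is what reduces the system of four sequences to a
    recurrence of order three. *)
Lemma state_counts_exist n : exists a p g, state_counts n.+1 a p (p + g) g.
Proof.
elim: n => [|n [a [p [g IH]]]]; first by exists 1, 0, 0; exact: state_counts1.
by eexists _, _, _; exact: (state_countsS IH).
Qed.

Lemma a9_count n a p q g : state_counts n.+1 a p q g -> a9 n.+1 = a.
Proof. by case=> va _ _ _; rewrite a9E card_continuations_start. Qed.

Theorem theorem26 :
  [/\ a9 0 = 1%N, a9 1 = 1%N, a9 2 = 3%N, a9 3 = 12%N &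
      forall n : nat, (4 <= n)%N ->
        ((a9 n)%:Z = 6 * (a9 (n - 1))%:Z - 8 * (a9 (n - 2))%:Z
                     + 2 * (a9 (n - 3))%:Z)%R].
Proof.
have c1 := state_counts1.
have c2 := state_countsS c1; have c3 := state_countsS c2.
split; first exact: a9_0.
- exact: (a9_count c1).
- exact: (a9_count c2).
- exact: (a9_count c3).
case=> [|[|[|[|n]]]] // _; rewrite !subSS subn0.
have [a [p [g d1]]] := state_counts_exist n.
have d2 := state_countsS d1; have d3 := state_countsS d2.
have d4 := state_countsS d3.
rewrite (a9_count d1) // (a9_count d2) // (a9_count d3) // (a9_count d4) //.
lia.
Qed.
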